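(* Every $2d$ hypergraphs that share the same vertex set and have a maximum degree of at most $d$ possess a cooperative coloring.
   Context: A hypergraph is a pair $(V,E)$ where $V$ is a set whose elements are called vertices, and $E$ is a family of subsets of $V$ called edges. The degree of a vertex is the number of edges containing it, and the maximum degree of a hypergraph is the largest degree of a vertex. A vertex subset $I$ of a hypergraph $H=(V,E)$ is an independent set if it does not fully contain any edge $e\in E$. Given a family $H_1,H_2,\ldots,H_m$ (not necessarily distinct) of hypergraphs with the same vertex set $V$, a cooperative coloring of them is a partition $\{I_1,I_2,\ldots,I_m\}$ of $V$ such that $I_i$ is an independent set in $H_i$ for each $i\in\{1,2,\ldots,m\}$.
   Formalization: Here d is at least 1 and every edge is assumed to contain at least two vertices; otherwise the claim fails, e.g. for a single vertex v when every hypergraph has {v} as an edge, or for d = 0 with a nonempty vertex set. *)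

(* Defs.v *)
From mathcomp Require Import all_boot.
From mathcomp Require Import boolp classical_sets functions cardinality.

Set Implicit Arguments.
Unset Strict Implicit.
Unset Printing Implicit Defensive.

Local Open Scope classical_set_scope.
Local Open Scope card_scope.

(* The vertex set is an arbitrary type, and neither the vertex set nor the
   edges are assumed finite. *)
Record hypergraph (V : Type) : Type := Hypergraph { edges : set (set V) }.

Definition incident_edges (V : Type) (H : hypergraph V) (v : V) : set (set V) :=
  [set e | edges H e /\ e v].

(* The degree of v is the cardinality of incident_edges H v, bounded here
   through the comparison of cardinalities #<=, so a vertex of infinite degree
   violates the bound.  The bound holds vacuously when V is empty. *)
Definition max_degree_le (V : Type) (H : hypergraph V) (d : nat) : Prop :=
  forall v : V, incident_edges H v #<= `I_d.

(* A hypergraph with an empty edge has no independent set, and a vertex that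
   is a singleton edge of every hypergraph of a family cannot be coloured. *)
Definition edges_nontrivial (V : Type) (H : hypergraph V) : Prop :=
  forall e : set V, edges H e -> `I_2 #<= e.

Definition independent (V : Type) (H : hypergraph V) (I : set V) : Prop :=
  forall e : set V, edges H e -> ~ (e `<=` I).

(* The classes partition V but may be empty, so classical_sets.partition,
   which requires nonempty blocks, does not apply. *)
Definition cooperative_coloring (V : Type) (m : nat)
    (H : 'I_m -> hypergraph V) (I : 'I_m -> set V) : Prop :=
  [/\ cover [set: 'I_m] I = [set: V],
      trivIset [set: 'I_m] I
    & forall i : 'I_m, independent (H i) (I i)].

(* Main.v *)
Require Import Defs.
From mathcomp Require Import all_boot.
From mathcomp Require Import boolp classical_sets functions cardinality.
From mathcomp Require Import finmap filter.

(* Keeping two vertices of each edge turns the hypergraphs into graphs G_i of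
   maximum degree at most d.  A cooperative coloring of finite graphs G_i on V
   is an independent set meeting every class {v} x [2d] in the disjoint union
   of the G_i, which exists by Haxell's theorem because the classes have 2d
   vertices.  An ultrafilter on the finite subsets of V glues the colorings of
   the finite subgraphs.

   For Haxell's theorem, delete edges until some xy is critical: there is no
   independent transversal, but there is one once xy is deleted.  Then 2(s - 1)
   vertices dominate the union of some s classes, which contradicts the degree
   bound.  To find them, delete the neighbours of x and y and merge the classes
   of x and y: there is still no independent transversal, and after deleting
   edges there is a critical edge meeting the merged class, so that induction
   applies.  Requiring the chosen classes to include that of x forces the merged
   class among those given by the induction; splitting it and adding x and y to
   the dominating set concludes. *)

Set Implicit Arguments.
Unset Strict Implicit.
Unset Printing Implicit Defensive.

(** * Critical edges and Haxell's theorem *)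

Definition del_edge (U : eqType) (E : rel U) (x y : U) : rel U :=
  fun u v => E u v && ~~ ((u == x) && (v == y) || (u == y) && (v == x)).

(** An independent transversal of the classes [p u = Some k] for [k] in [C]; as [f] is total, its
    values outside [C] are arbitrary. *)
Definition rainbow_independent (U : Type) (K : finType) (E : rel U)
    (p : U -> option K) (C : {set K}) (f : K -> U) : Prop :=
  {in C, forall k, p (f k) = Some k} /\ {in C &, forall k l, ~~ E (f k) (f l)}.

Lemma del_edge_sym (U : eqType) (E : rel U) (x y : U) :
  symmetric E -> symmetric (del_edge E x y).
Proof.
move=> Esym u v; rewrite /del_edge Esym orbC.
by rewrite [(u == y) && _]andbC [(u == x) && _]andbC.
Qed.

(** Edges meeting [B] are deleted one at a time. Once none is left a transversal exists, so some
    deletion is the first to create one; [B] prescribes where that critical edge lies. *)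
Lemma critical_edge (U K : finType) (p : U -> option K) (C : {set K})
    (B : {set U}) (E : rel U) :
  symmetric E -> irreflexive E ->
  ~ (exists f, rainbow_independent E p C f) ->
  (exists f,
     rainbow_independent [rel u v | [&& E u v, u \notin B & v \notin B]] p C f) ->
  exists E' : rel U, exists x y : U,
    [/\ symmetric E', irreflexive E', subrel E' E, E' x y & x \in B] /\
    ~ (exists f, rainbow_independent E' p C f) /\
    exists f, rainbow_independent (del_edge E' x y) p C f.
Proof.
move: {2}_.+1 (ltnSn #|[set z : U * U | E z.1 z.2 && (z.1 \in B)]|) => n.
elim: n E => // n IHn E leEn Esym Eirr noE hasB.
have [[x [y /andP[Exy xB]]]|noedge] :=
    pselect (exists x y, E x y && (x \in B)); last first.
  case: noE; case: hasB => f [fp fE]; exists f; split=> // k l kC lC.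
  apply: contra (fE k l kC lC) => /= Ekl; rewrite Ekl /=.
  apply/andP; split; apply/negP => inB; apply: noedge.
    by exists (f k), (f l); rewrite Ekl.
  by exists (f l), (f k); rewrite Esym Ekl.
have [hasT|noT] := pselect (exists f, rainbow_independent (del_edge E x y) p C f).
  by exists E, x, y; split; first split.
have dsub : subrel (del_edge E x y) E by move=> u v /andP[].
have [||||E' [x' [y' [[sy ir sb E'xy x'B] H]]]] := IHn (del_edge E x y) _ _ _ noT.
- rewrite -ltnS; apply: leq_trans leEn; rewrite ltnS; apply: proper_card.
  apply/properP; split.
    by apply/fintype.subsetP => z; rewrite !inE => /andP[/dsub -> ->].
  by exists (x, y); rewrite !inE /= ?Exy ?xB // /del_edge !eqxx /= andbF.
- exact: del_edge_sym.
- by move=> u; rewrite /del_edge Eirr.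
- case: hasB => f [fp fE]; exists f; split=> // k l kC lC.
  by apply: contra (fE k l kC lC) => /= /and3P[/dsub -> -> ->].
exists E', x', y'; split=> //; split=> //.
by move=> u v /sb /dsub.
Qed.

(* The value None of [p] marks the vertices deleted from the graph. *)
Lemma critical_domination (U K : finType) (p : U -> option K) (C : {set K})
    (E : rel U) (x y : U) :
  symmetric E -> irreflexive E -> E x y ->
  ~ (exists f, rainbow_independent E p C f) ->
  (exists f, rainbow_independent (del_edge E x y) p C f) ->
  exists (S : {set K}) (D : {set U}),
    [/\ S \subset C, exists2 i, p x = Some i & i \in S, #|D| + 2 <= 2 * #|S|
      & forall u k, p u = Some k -> k \in S -> exists2 v, v \in D & E u v].
Proof.
move: {2}_.+1 (ltnSn #|C|) => n.
elim: n p C E x y => // n IHn p C E x y leCn Esym Eirr Exy noE [f [fp fE]].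
have neq_xy : x != y by apply: contraTneq Exy => ->; rewrite Eirr.
(* The transversal [f] uses both [x] and [y], since otherwise it would already be one for [E]. *)
have [i [j [iC jC fi fj]]] : exists i j, [/\ i \in C, j \in C, f i = x & f j = y].
  apply: contrapT => nox; apply: noE; exists f; split=> // k l kC lC.
  apply: contra (fE k l kC lC) => Ekl; rewrite /del_edge Ekl /=.
  apply/negP => /orP[] /andP[/eqP kx /eqP ly]; apply: nox.
    by exists k, l.
  by exists l, k.
have px : p x = Some i by rewrite -fi fp.
have py : p y = Some j by rewrite -fj fp.
have neq_ij : i != j by apply: contraNneq neq_xy => ij; rewrite -fi -fj ij.
(* The deleted neighbours include [x] and [y] themselves; what is left of class [j] joins class
   [i]. *)
pose p' u := if E u x || E u y then None
             else if p u == Some j then Some i else p u.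
have p'N u k : p' u = Some k -> ~~ E u x /\ ~~ E u y.
  by rewrite /p'; case: ifP => // /negbT; rewrite negb_or => /andP.
have p'p u k : p' u = Some k -> k != i -> p u = Some k.
  rewrite /p'; case: ifP => // _; case: ifP => // _ [->].
  by rewrite eqxx.
pose C' := C :\ j.
have C'C k : k \in C' -> k \in C by rewrite !inE => /andP[].
have C'j k : k \in C' -> k != j by rewrite !inE => /andP[].
have ltC' : #|C'| < n.
  by rewrite -ltnS (leq_trans _ leCn) // ltnS [in X in _ < X](cardsD1 j) jC.
have iC' : i \in C' by rewrite !inE neq_ij.
(* Given a transversal [g] of the merged classes, [g i] serves its original class and [x] or [y]
   serves the other one, being adjacent to no chosen vertex. *)
have noE' : ~ (exists g, rainbow_independent E p' C' g).
  case=> g [gp gE].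
  have gN k : k \in C' -> ~~ E (g k) x /\ ~~ E (g k) y.
    by move=> kC'; apply: p'N (gp _ kC').
  (* [a, b] are the classes of [i, j] in the order given by [g i] *)
  have [a [b [z [zxy pz pgi abij]]]] : exists a b z,
      [/\ z = x \/ z = y, p z = Some b, p (g i) = Some a &
          (a = i /\ b = j) \/ (a = j /\ b = i)].
    have := gp _ iC'; rewrite /p'; case: ifP => // _; case: eqP => [pj _|_ pi].
      by exists j, i, x; split; auto.
    by exists i, j, y; split; auto.
  have neq_ab : a != b by case: abij => [] [-> ->] //; rewrite eq_sym.
  have inC' k : k \in C -> k != a -> k != b -> k \in C' /\ k != i.
    move=> kC ka kb; rewrite !inE kC andbT.
    by case: abij => -[ea eb]; rewrite -ea -eb; split.
  have zN k : k \in C' -> ~~ E (g k) z.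
    by move=> /gN[]; case: zxy => ->.
  pose h k := if k == a then g i else if k == b then z else g k.
  have gE' k : k \in C -> k != b -> exists2 l, l \in C' & h k = g l.
    move=> kC kb; rewrite /h (negPf kb); case: eqP => [_|/eqP ka]; first by exists i.
    by have [kC' _] := inC' _ kC ka kb; exists k.
  have hb : h b = z by rewrite /h eqxx eq_sym (negPf neq_ab).
  apply: noE; exists h; split=> [k kC|k l kC lC].
    rewrite /h; case: eqP => [->//|/eqP ka]; case: eqP => [->//|/eqP kb].
    have [kC' ki] := inC' _ kC ka kb.
    exact: p'p (gp _ kC') ki.
  have [->|kb] := eqVneq k b; have [->|lb] := eqVneq l b; rewrite ?hb ?Eirr //.
  - by have [m mC' ->] := gE' _ lC lb; rewrite Esym zN.
  - by have [m mC' ->] := gE' _ kC kb; rewrite zN.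
  - have [m mC' ->] := gE' _ kC kb; have [m' m'C' ->] := gE' _ lC lb.
    exact: gE.
pose B := [set u | p' u == Some i].
have cover_p u k (S : {set K}) : p u = Some k -> k \in j |: S -> i \in S ->
    ~~ E u x -> ~~ E u y -> exists2 l, p' u = Some l & l \in S.
  move=> pu kS iS ux uy; rewrite /p' (negPf ux) (negPf uy) /= pu.
  case: eqP => [_|kj]; first by exists i.
  exists k => //; move: kS; rewrite !inE => /orP[/eqP kj'|//].
  by case: kj; rewrite kj'.
(* If the merged class is empty, [x] and [y] already dominate the classes [i] and [j]. *)
have [B0|[b bB]] := set_0Vmem B.
  exists [set i; j], [set x; y]; split.
  - by apply/fintype.subsetP => k; rewrite !inE => /orP[] /eqP->.
  - by exists i; rewrite // !inE eqxx.
  - by rewrite !cards2 neq_xy neq_ij.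
  - move=> u k pu kS.
    have [ux|ux] := boolP (E u x); first by exists x; rewrite // !inE eqxx.
    have [uy|uy] := boolP (E u y); first by exists y; rewrite // !inE eqxx orbT.
    have [||l p'u /set1P li] := cover_p u k [set i] pu _ _ ux uy.
    + by move: kS; rewrite !inE orbC.
    + by rewrite inE.
    suff: u \in B by rewrite B0 inE.
    by rewrite inE p'u li.
have fN k : k \in C' -> k != i -> f k != x /\ f k != y.
  move=> kC' ki; split; apply: contraTneq (kC') => fk.
    have := fp k (C'C _ kC'); rewrite fk px => -[ik].
    by rewrite ik eqxx in ki.
  by have := fp k (C'C _ kC'); rewrite fk py => -[<-]; rewrite !inE eqxx.
have fE' k l : k \in C' -> k != i -> l \in C -> ~~ E (f k) (f l).
  move=> kC' ki lC; have [kx ky] := fN _ kC' ki.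
  have := fE k l (C'C _ kC') lC.
  by rewrite /del_edge (negPf kx) (negPf ky) /= andbT.
(* Once the edges at [B] are gone, [f] with [f i] replaced by [b] is a transversal: its other values
   are adjacent to neither [x] nor [y], hence survive in [p']. *)
have [|E' [x' [y' [[sy ir sb E'xy x'B] [noE'' hasE'']]]]] :=
    @critical_edge U K p' C' B E Esym Eirr noE'.
  exists (fun k => if k == i then b else f k); split=> [k kC'|k l kC' lC'].
    case: eqP => [->|/eqP ki]; first by move: bB; rewrite inE => /eqP.
    have := fE' _ _ kC' ki iC; have := fE' _ _ kC' ki jC.
    rewrite fi fj /p' => /negPf-> /negPf->; rewrite fp ?C'C //.
    by case: eqP => // -[kj]; have := C'j _ kC'; rewrite kj eqxx.
  case: (eqVneq k i) => [_|ki] /=; first by rewrite bB andbF.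
  case: (eqVneq l i) => [_|li] /=; first by rewrite bB !andbF.
  by rewrite (negPf (fE' _ _ kC' ki (C'C _ lC'))).
have [S [D [SC [i' p'x i'S] leD dom]]] := IHn _ _ _ _ _ ltC' sy ir E'xy noE'' hasE''.
have iS : i \in S by move: x'B; rewrite inE p'x => /eqP[<-].
have jS : j \notin S by apply/negP => /(fintype.subsetP SC); rewrite !inE eqxx.
(* Adding [j] raises [2 * #|S|] by 2, which pays for [x] and [y]. *)
exists (j |: S), (x |: (y |: D)); split.
- rewrite finset.subUset finset.sub1set jC; apply/fintype.subsetP => k /(fintype.subsetP SC).
  exact: C'C.
- by exists i => //; rewrite !inE iS orbT.
- rewrite [in X in _ <= X]cardsU1 jS mulnDr [2 * _ + _]addnC.
  apply: leq_trans (leq_add leD (leqnn _)); rewrite addnAC leq_add2r.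
  by rewrite !cardsU1 addnA addnC leq_add2l; do 2 case: (_ \notin _).
- move=> u k pu kS.
  have [ux|ux] := boolP (E u x); first by exists x; rewrite // !inE eqxx.
  have [uy|uy] := boolP (E u y); first by exists y; rewrite // !inE eqxx orbT.
  have [l p'u lS] := cover_p u k S pu kS iS ux uy.
  have [v vD /sb Euv] := dom _ _ p'u lS.
  by exists v; rewrite // !inE vD !orbT.
Qed.

(** Double counting: the classes in [S] have at least [2 * d * #|S|] vertices, but [D] dominates at
    most [d * #|D|], and [#|D| + 2 <= 2 * #|S|]. *)
Lemma rainbow_independent_exists (U K : finType) (p : U -> option K) (E : rel U)
    (d : nat) :
  0 < d -> symmetric E -> irreflexive E ->
  (forall u, #|[set v | E u v]| <= d) ->
  (forall k, 2 * d <= #|[set u | p u == Some k]|) ->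
  exists f, rainbow_independent E p [set: K] f.
Proof.
move=> d_gt0 Esym Eirr Edeg psize; apply: contrapT => noE.
have u0 k : exists u, p u = Some k.
  have : 0 < #|[set u | p u == Some k]| by apply: leq_trans (psize k); rewrite muln_gt0.
  by case/card_gt0P => u; rewrite inE => /eqP; exists u.
have [f fp] := choice u0.
have [|E' [x [y [[sy ir sb E'xy _] [noE' hasE']]]]] :=
    @critical_edge U K p [set: K] [set: U] E Esym Eirr noE.
  by exists f; split=> // k l _ _ /=; rewrite inE andbF.
have [S [D [_ _ leD dom]]] := critical_domination sy ir E'xy noE' hasE'.
have : 2 * d * #|S| <= d * #|D|.
  have -> : 2 * d * #|S| = \sum_(k in S) 2 * d by rewrite sum_nat_const mulnC.
  (* Empty for [k] outside [S], so that the disjoint union can range over all of [K]. *)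
  pose F k := [set u | (k \in S) && (p u == Some k)].
  apply: (@leq_trans (\sum_k #|F k|)).
    rewrite big_mkcond; apply: leq_sum => k _; case: ifP => // kS.
    by rewrite /F kS; apply: psize.
  apply: (@leq_trans #|\bigcup_(v in D) [set u | E v u]|).
    under eq_bigr do rewrite -sum1_card.
    rewrite -partition_disjoint_bigcup ?sum1_card => [|k l kl]; last first.
      apply/pred0P => u /=; rewrite !inE; apply/negP.
      by move=> /andP[/andP[_ /eqP->] /andP[_ /eqP[/eqP]]]; rewrite (negPf kl).
    apply/subset_leq_card/fintype.subsetP => u /finset.bigcupP[k _].
    rewrite inE => /andP[kS /eqP pu]; have [v vD /sb Euv] := dom _ _ pu kS.
    by apply/finset.bigcupP; exists v; rewrite // inE Esym.
  rewrite mulnC -sum_nat_const.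
  apply: leq_trans (leq_sum _ (fun v _ => Edeg v)).
  elim/big_rec2: _ => [|v n A _ leA]; first by rewrite cards0.
  by apply: leq_trans (leq_card_setU _ _) _; rewrite leq_add2l.
rewrite -mulnA mulnCA leq_pmul2l // => leS.
by move: (leq_trans leD leS); rewrite addn2 => /ltnW; rewrite ltnn.
Qed.

(** * Cooperative colorings of graphs and compactness *)

(** The set [A] localizes the condition for the compactness argument; [v <> w] discards the loops
    that [G] may have. *)
Definition cooperative (V C : Type) (G : C -> V -> V -> Prop) (A : V -> Prop)
    (c : V -> C) : Prop :=
  forall v w, A v -> A w -> v <> w -> c v = c w -> ~ G (c v) v w.

Lemma finite_cooperative (V : finType) (d : nat) (G : 'I_(2 * d) -> rel V) :
  0 < d -> (forall i, symmetric (G i)) ->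
  (forall i v, #|[set w | (w != v) && G i v w]| <= d) ->
  exists c, cooperative G (fun=> True) c.
Proof.
move=> d_gt0 Gsym Gdeg.
pose E := [rel u v : V * 'I_(2 * d) | [&& v.1 != u.1, u.2 == v.2 & G u.2 u.1 v.1]].
have Esym : symmetric E.
  move=> [u i] [v j] /=; rewrite [v == u]eq_sym [j == i]eq_sym.
  by case: (eqVneq i j) => [->|]; rewrite ?andbF // Gsym.
have Eirr : irreflexive E by move=> [u i] /=; rewrite eqxx.
have [||f [fp fE]] :=
    @rainbow_independent_exists _ _ (fun u : V * 'I_(2 * d) => Some u.1) E d d_gt0 Esym Eirr.
- move=> [v i]; apply: leq_trans (Gdeg i v).
  have pair_inj : injective (fun w : V => (w, i)) by move=> a b [].
  rewrite -(card_imset _ pair_inj).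
  apply/subset_leq_card/fintype.subsetP => -[w j]; rewrite inE /= => /and3P[vw /eqP ij Gvw].
  by apply/imsetP; exists w; rewrite ?inE ?vw ?ij //; rewrite -ij.
- move=> v; have pair_inj : injective (pair v : 'I_(2 * d) -> _) by move=> a b [].
  rewrite -[X in X <= _]card_ord -cardsT -(card_imset _ pair_inj).
  apply/subset_leq_card/fintype.subsetP => _ /imsetP[i _ ->].
  by rewrite inE.
have f1 v : (f v).1 = v by have [] := fp v (finset.in_setT v).
exists (fun v => (f v).2) => v w _ _ vw cvw Gvw.
have := fE v w (finset.in_setT v) (finset.in_setT w).
by rewrite /= !f1 cvw eqxx -cvw Gvw andbT eq_sym; move/eqP: vw => ->.
Qed.

(** Each vertex gets the color that it has in the colorings of [W]-almost all finite sets [F]. *)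
Lemma cooperative_compactness (V : choiceType) (C : finType)
    (G : C -> V -> V -> Prop) :
  (forall F : {fset V}, exists c, cooperative G (fun v => v \in F) c) ->
  exists c, cooperative G (fun=> True) c.
Proof.
move=> /choice[c cP].
pose cone (F : {fset V}) : set {fset V} := [set F' | F `<=` F']%fset%classic.
have coneP : ProperFilter (filter_from setT cone).
  apply: filter_from_proper; last by move=> F _; exists F; apply: fsubset_refl.
  apply: filter_from_filter; first by exists fset0.
  move=> F F' _ _; exists (F `|` F')%fset => // X.
  by rewrite /cone /= fsubUset => /andP[].
have [W [WU sub_W]] := ultraFilterLemma coneP.
have WF : ProperFilter W by exact: ultra_proper.
have W1 v : W [set F | v \in F]%classic.
  by apply: sub_W; exists [fset v]%fset => // F; rewrite /cone /= fsub1set.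
(* As [C] is finite, if every color were avoided [W]-almost always, all would be avoided at once for
   some [F]. *)
have colour v : exists i, W [set F | c F v = i]%classic.
  apply: contrapT => noi.
  have /filter_ex[F] : W [set F | forall i, c F v <> i]%classic.
    apply: filter_forall => i.
    by have [Wi|//] := in_ultra_setVsetC [set F | c F v = i]%classic WU; case: noi; exists i.
  by move/(_ (c F v)).
have [c' c'P] := choice colour.
exists c' => v w _ _ vw cvw.
have /filter_ex[F [[Fv Fw] [/= vF wF]]] :
    W ([set F | v \in F] `&` [set F | w \in F] `&`
       ([set F | c F v = c' v] `&` [set F | c F w = c' w]))%classic.
  by do 2!apply: filterI.
by rewrite -vF; apply: (cP F) => //; rewrite vF wF.
Qed.

(** * From hypergraphs to graphs *)

Lemma edge_ends (V : Type) (H : hypergraph V) : edges_nontrivial H ->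
  exists ends : set V -> set V, forall e, edges H e ->
    exists a b, [/\ a <> b, e a, e b & ends e = [set a; b]%classic].
Proof.
move=> Hnt; suff /choice[ends endsP] : forall e, exists s : set V, edges H e ->
    exists a b, [/\ a <> b, e a, e b & s = [set a; b]%classic] by exists ends.
move=> e; have [He|nHe] := pselect (edges H e); last by exists set0.
have [f] := card_leP (Hnt e He).
pose x0 : `I_2 := SigSub (mem_set (isT : `I_2 0)).
pose x1 : `I_2 := SigSub (mem_set (isT : `I_2 1)).
exists [set val (f x0); val (f x1)]%classic => _.
exists (val (f x0)), (val (f x1)); split=> //; try exact: set_valP.
by move=> /val_inj /inj; rewrite !classical_sets.in_setT => /(_ isT isT) /(congr1 val).
Qed.

(** Distinct neighbours of [v] come from distinct edges at [v], because the pair [ends e] contains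
    [v] and so determines the other end. *)
Lemma ends_degree (V : choiceType) (H : hypergraph V) (d : nat)
    (ends : set V -> set V) (F : {fset V}) (v : F) :
  max_degree_le H d ->
  (forall e, edges H e ->
    exists a b, [/\ a <> b, e a, e b & ends e = [set a; b]%classic]) ->
  #|[set w : F | (w != v) &&
      `[< exists e, [/\ edges H e, ends e (val v) & ends e (val w)] >]]| <= d.
Proof.
move=> Hdeg endsP; set W := finset _.
have /choice[e eP] : forall w, exists e, w \in W ->
    [/\ w != v, edges H e, ends e (val v) & ends e (val w)].
  move=> w; have [|nW] := boolP (w \in W); last by exists set0.
  by rewrite inE => /andP[wv /asboolP[e [He ev ew]]]; exists e.
have e_v w : w \in W -> incident_edges H (val v) (e w).
  move=> /eP[_ He ev _]; split=> //; have [a [b [_ ea eb eq_e]]] := endsP _ He.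
  by move: ev; rewrite eq_e => -[->|->].
have [g] := pcard_leP (Hdeg (val v)).
rewrite cardE -(size_map (g \o e)) -[d in _ <= d](size_iota 0).
apply: uniq_leq_size => [|_ /mapP[w + ->]]; last first.
  rewrite mem_enum => /e_v Hw; rewrite mem_iota /= add0n.
  exact: (@funS _ _ _ _ g _ Hw).
rewrite map_inj_in_uniq ?enum_uniq // => w w'; rewrite !mem_enum => wW w'W /= eq_g.
have eq_e : e w = e w' by apply: (@inj _ _ _ g); [exact/mem_set/e_v|exact/mem_set/e_v|].
have [/eqP wv He ev ew] := eP _ wW; have [/eqP w'v _ _ ew'] := eP _ w'W.
have neq (u : F) : u <> v -> val u <> val v by move=> uv /val_inj.
move: (neq _ wv) (neq _ w'v) ev ew ew'; rewrite -eq_e.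
have [a [b [_ _ _ ->]]] := endsP _ He.
by move=> /= nw nw' [] /= ev [] /= ew [] /= ew'; apply: val_inj => /=; congruence.
Qed.

Theorem proposition1p2 (V : Type) (d : nat) (d_gt0 : 0 < d)
    (H : 'I_(2 * d) -> hypergraph V)
    (H_edges : forall i : 'I_(2 * d), edges_nontrivial (H i))
    (H_deg : forall i : 'I_(2 * d), max_degree_le (H i) d) :
  exists I : 'I_(2 * d) -> set V, cooperative_coloring H I.
Proof.
have /choice[ends endsP] := fun i => edge_ends (H_edges i).
pose G i (v w : {classic V}) :=
  exists e, [/\ edges (H i) e, ends i e v & ends i e w].
have [|c cG] := @cooperative_compactness {classic V} _ G.
  move=> F; pose GF i : rel F := fun v w => `[< G i (val v) (val w) >].
  have [|i v|c cP] := @finite_cooperative F d GF d_gt0.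
  - move=> i v w; apply/asboolP/asboolP => -[e [He ev ew]]; by exists e.
  - exact: (@ends_degree {classic V} (H i) d (ends i) F v (H_deg i) (endsP i)).
  (* A default color for the vertices outside [F]. *)
  have i0 : 'I_(2 * d) by apply: (@Ordinal _ 0); rewrite muln_gt0.
  exists (fun v => if insub v is Some w then c w else i0) => v w vF wF vw.
  rewrite !insubT /= => cvw Gvw; apply: (cP (Sub v vF) (Sub w wF)) => //.
    by move=> /(congr1 val).
  exact/asboolP.
exists (fun i => [set v | c v = i]%classic); split.
- by apply/seteqP; split=> // v _; exists (c v).
- by move=> i j _ _ [v [/= <- <-]].
(* An edge inside color class [i] would have both of its chosen ends colored [i], although they are
   adjacent in [G i]. *)
- move=> i e He sub_e; have [a [b [ab ea eb eq_e]]] := endsP i e He.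
  have [ca cb] := (sub_e _ ea, sub_e _ eb).
  apply: (cG a b) => //; first by rewrite ca cb.
  by rewrite ca; exists e; rewrite eq_e; split=> //; [left|right].
Qed.
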